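(* Let $X$ be a Tychonoff space and let $\aleph_\alpha\geq\aleph_1$ be a cardinal. Then $$\pi\chi(C_{\aleph_\alpha}(X))=\chi(C_{\aleph_\alpha}(X))=uw(C_{\aleph_\alpha}(X))=cc_{\aleph_\alpha}(X).$$
   Context: Tychonoff means completely regular and Hausdorff. $C(X)$ is the set of all real-valued continuous functions on $X$. For an infinite cardinal $\aleph_\alpha$, $\mathcal{A}_{\aleph_\alpha}=\{A\subseteq X: |A|<\aleph_\alpha\}$. For $f\in C(X)$, $A\in\mathcal{A}_{\aleph_\alpha}$ and real $\epsilon>0$ put $B(f,A,\epsilon)=\{g\in C(X): \sup_{x\in A}|f(x)-g(x)|<\epsilon\}$ (equal to $C(X)$ when $A=\emptyset$). The sets $B(f,A,\epsilon)$ form a base of a topology on $C(X)$; $C_{\aleph_\alpha}(X)$ denotes $C(X)$ with this topology. A family $\mathcal{B}\subseteq\mathcal{A}_{\aleph_\alpha}$ is an $\aleph_\alpha$-closed family in $X$ if for every $A\in\mathcal{A}_{\aleph_\alpha}$ there is $B\in\mathcal{B}$ with $A\subseteq\overline{B}$, and $cc_{\aleph_\alpha}(X)=\aleph_0+\min\{|\mathcal{B}|: \mathcal{B}\text{ is an }\aleph_\alpha\text{-closed family in }X\}$. For a space $Y$ and $y\in Y$: $\chi(y,Y)=\aleph_0+$ the minimal cardinality of an open local base at $y$, and $\chi(Y)=\sup_{y}\chi(y,Y)$ (character); a local $\pi$-base at $y$ is a collection $\mathcal{V}$ of non-empty open sets such that every open neighborhood of $y$ contains some $V\in\mathcal{V}$,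 $\pi\chi(y,Y)=\aleph_0+$ the minimal cardinality of a local $\pi$-base at $y$, and $\pi\chi(Y)=\sup_y\pi\chi(y,Y)$ ($\pi$-character). For a Tychonoff space $Y$, the uniform weight $uw(Y)$ is the least infinite cardinal $\kappa$ such that some uniformity compatible with the topology of $Y$ has a base of cardinality at most $\kappa$. *)

(* Defs.v *)
From HB Require Import structures.
From mathcomp Require Import all_boot all_order all_algebra.
From mathcomp Require Import all_classical all_reals all_analysis.

Set Implicit Arguments.
Unset Strict Implicit.
Unset Printing Implicit Defensive.

Import Order.TTheory GRing.Theory Num.Theory.
Import numFieldNormedType.Exports.

Local Open Scope classical_set_scope.
Local Open Scope card_scope.
Local Open Scope ring_scope.

(* A cardinal number is given by a type of that cardinality: for types K and L,
   [set: K] #= [set: L] is equality of cardinals, [set: K] #<= [set: L] is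
   their order, and (K + L)%type is their sum. *)

(* The least cardinal satisfying P, determined up to #=.  The default value is
   never used when P is inhabited, by least_cardP below. *)
Definition least_card (P : Type -> Prop) : Type :=
  match pselect (exists K, P K /\ forall L, P L -> [set: K] #<= [set: L]) with
  | left h => projT1 (cid h)
  | right _ => Empty_set
  end.

Lemma least_subset_card (T : Type) (F : set (set T)) : F !=set0 ->
  exists2 A, F A & forall B, F B -> A #<= B.
Proof.
move=> [A0 FA0].
pose I := {A : set T | F A}.
pose P : set (set (I -> T)) := [set S |
  (forall s, S s -> forall i : I, sval i (s i)) /\
  (forall s t i, S s -> S t -> s i = t i -> s = t)].
have [S [[Smem Sinj] Smax]] : exists A, P A /\ forall B, A `<` B -> ~ P B.
  apply: Zorn_bigcup => G GP Gtot; split=> [s [X GX Xs] i|s t i].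
    by have [+ _] := GP _ GX; apply.
  move=> [X GX Xs] [Y GY Yt]; have [XY|YX] := Gtot _ _ GX GY.
    by have [_ inj] := GP _ GY; apply: inj => //; exact: XY.
  by have [_ inj] := GP _ GX; apply: inj => //; exact: YX.
have [i Si] : exists i : I, forall x, sval i x -> exists2 s, S s & s i = x.
  apply: contrapT => nS.
  have miss (i : I) : exists x, sval i x /\ forall s, S s -> s i <> x.
    apply: contrapT => ni; apply: nS; exists i => x ix.
    apply: contrapT => nx; apply: ni; exists x; split=> // s Ss six.
    by apply: nx; exists s.
  pose f i := projT1 (cid (miss i)).
  have fP i : sval i (f i) /\ forall s, S s -> s i <> f i.
    exact: projT2 (cid (miss i)).
  apply: (Smax (S `|` [set f])).
    split; first by move=> s Ss; left.
    move=> /(_ f (or_intror erefl)) Sf.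
    by have [_ /(_ _ Sf)] := fP (exist _ A0 FA0).
  split=> [s [Ss i|-> i]|s t i]; [exact: Smem|by case: (fP i)|].
  case=> [Ss|->] [St|->] //; first exact: Sinj.
  - by have [_ /(_ _ Ss)] := fP i.
  - by have [_ /(_ _ St) + /esym] := fP i.
exists (sval i); first exact: (svalP i).
move=> B FB; pose j : I := exist _ B FB.
pose g x := if pselect (exists s, S s /\ s i = x) is left h
  then projT1 (cid h) j else x.
have gP x : sval i x -> exists s, [/\ S s, s i = x & g x = s j].
  move=> /Si[s Ss six]; rewrite /g; case: pselect => [h|[]]; last by exists s.
  by case: (cid h) => t [St tix] /=; exists t.
have /injfunPex[f] :
    exists2 f : T -> T, set_fun (sval i) B f & set_inj (sval i) f.
  exists g => [x /gP[s [Ss _ ->]]|x y /set_mem/gP[s [Ss <- ->]]].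
    exact: (Smem s Ss j).
  by move=> /set_mem/gP[t [St <- ->]] /(Sinj _ _ _ Ss St) ->.
exact: inj_card_le.
Qed.

Lemma card_le_total (K L : Type) :
  [set: K] #<= [set: L] \/ [set: L] #<= [set: K].
Proof.
pose A : set (K + L) := range inl; pose B : set (K + L) := range inr.
have AK : A #= [set: K] by apply: inj_card_eq => x y _ _ [].
have BL : B #= [set: L] by apply: inj_card_eq => x y _ _ [].
have [|C [->|->] CP] := @least_subset_card _ [set A; B].
- by exists A; left.
- left; have := CP _ (or_intror erefl).
  by rewrite (card_le_eql AK) (card_le_eqr BL).
- right; have := CP _ (or_introl erefl).
  by rewrite (card_le_eql BL) (card_le_eqr AK).
Qed.

Lemma least_cardP (P : Type -> Prop) : (exists K, P K) ->
  P (least_card P) /\ forall L, P L -> [set: least_card P] #<= [set: L].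
Proof.
move=> [K PK]; rewrite /least_card; case: pselect => [h|[]].
  exact: (projT2 (cid h)).
have [|A [L PL LA] Amin] := @least_subset_card K
    [set A | exists2 L, P L & [set: L] #= A].
  by exists setT, K.
exists L; split=> // M PM; rewrite (card_le_eql LA).
have [MK|KM] := card_le_total M K; last exact: card_le_trans (card_leT A) KM.
have /card_subP[B BM _] := MK.
by rewrite -(card_le_eqr BM); apply: Amin; exists M; rewrite // card_eq_sym.
Qed.

Definition aleph1 : Type := least_card (fun K => ~ countable [set: K]).

Definition tychonoff_space (X : topologicalType) : Prop :=
  completely_regular_space X /\ hausdorff_space X.

(* The sets of cardinality < kappa. *)
Definition small_sets (X : Type) (kappa : Type) : set (set X) :=
  [set A | A #<= [set: kappa] /\ A #!= [set: kappa]].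

(* C_kappa(X) is a copy of the type of continuous functions, because the
   latter already carries another topology. *)
Definition Ckappa (R : realType) (X : topologicalType) (kappa : Type) : Type :=
  continuousType X R.

HB.instance Definition _ (R : realType) (X : topologicalType) (kappa : Type) :=
  Choice.copy (Ckappa R X kappa) (continuousType X R).

(* The supremum is taken in \bar R: it is +oo when f - g is unbounded on A, and
   -oo when A is empty, so that the ball is then the whole space. *)
Definition sup_ball (R : realType) (X : topologicalType) (kappa : Type)
    (f : Ckappa R X kappa) (A : set X) (eps : R) : set (Ckappa R X kappa) :=
  [set g | (ereal_sup [set (`|(f : continuousType X R) x
     - (g : continuousType X R) x|)%:E | x in A] < eps%:E)%E].

(* The topology is generated by the sets sup_ball f A eps; for an infinite kappa
   these sets form a base of it. *)
HB.instance Definition _ (R : realType) (X : topologicalType) (kappa : Type) :=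
  @isSubBaseTopological.Build (Ckappa R X kappa) (set (Ckappa R X kappa))
    [set U | exists f A eps,
       [/\ small_sets kappa A, 0 < eps & U = sup_ball f A eps]]
    id.

Definition closed_family (X : topologicalType) (kappa : Type)
    (F : set (set X)) : Prop :=
  F `<=` small_sets kappa /\
  forall A, small_sets kappa A -> exists2 B, F B & A `<=` closure B.

Definition cc (X : topologicalType) (kappa : Type) : Type :=
  (nat + least_card (fun K => exists2 F : set (set X),
     closed_family kappa F & [set: K] #= F))%type.

Definition local_base (Y : topologicalType) (y : Y) (F : set (set Y)) : Prop :=
  F `<=` open_nbhs y /\
  forall U, open_nbhs y U -> exists2 V, F V & V `<=` U.

Definition local_pi_base (Y : topologicalType) (y : Y)
    (F : set (set Y)) : Prop :=
  F `<=` [set V | open V /\ V !=set0] /\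
  forall U, open_nbhs y U -> exists2 V, F V & V `<=` U.

Definition character_at (Y : topologicalType) (y : Y) : Type :=
  (nat + least_card (fun K => exists2 F : set (set Y),
     local_base y F & [set: K] #= F))%type.

Definition pi_character_at (Y : topologicalType) (y : Y) : Type :=
  (nat + least_card (fun K => exists2 F : set (set Y),
     local_pi_base y F & [set: K] #= F))%type.

(* The least upper bound of a family of cardinals. *)
Definition card_sup (I : Type) (k : I -> Type) : Type :=
  least_card (fun K => forall i, [set: k i] #<= [set: K]).

Definition character (Y : topologicalType) : Type := card_sup (@character_at Y).

Definition pi_character (Y : topologicalType) : Type :=
  card_sup (@pi_character_at Y).

(* E is the set of entourages of a uniformity inducing the topology of Y; these
   are the axioms of the library's uniformType, as a predicate on E. *)
Definition compatible_uniformity (Y : topologicalType)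
    (E : set_system (Y * Y)) : Prop :=
  [/\ Filter E,
      forall A, E A -> diagonal `<=` A,
      forall A, E A -> E (A^-1)%relation,
      forall A, E A -> exists2 B, E B & (B \; B)%relation `<=` A &
      @nbhs Y Y = nbhs_ E].

Definition uniformity_base (Y : Type) (E F : set_system (Y * Y)) : Prop :=
  F `<=` E /\ forall V, E V -> exists2 W, F W & W `<=` V.

Definition uniform_weight (Y : topologicalType) : Type :=
  least_card (fun K => infinite_set [set: K] /\
    exists E F : set_system (Y * Y),
      [/\ compatible_uniformity E, uniformity_base E F & F #<= [set: K]]).

(* Main.v *)
(* The cardinals are compared along a cycle: pi-character <= character is
   immediate; character <= uniform weight because slicing a base of a uniformity
   at a point gives a local base; uniform weight <= cc because the entourages
   {(f, g) | sup_A |f - g| < 1/(n+1)}, for A in a closed family and n in nat, are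
   a base of the natural uniformity (a supremum over A bounds the one over the
   closure of A), and there are at most aleph_0 + |family| of them.
   Finally cc <= pi-character: pick in each member of a local pi-base at f a ball
   B(g, A, e).  If B(g, A, e) lies in B(f, A', 1) then A' is contained in the
   closure of A, since otherwise complete regularity allows one to modify g
   outside A by 2 at a point of A'.  So the chosen sets A form a closed family. *)
Require Import Defs.
From mathcomp Require Import all_boot all_order all_algebra.
From mathcomp Require Import all_classical all_reals all_analysis.
From mathcomp Require Import lra.

Set Implicit Arguments.
Unset Strict Implicit.
Unset Printing Implicit Defensive.

Import Order.TTheory GRing.Theory Num.Theory.
Import numFieldNormedType.Exports.

Local Open Scope classical_set_scope.
Local Open Scope card_scope.

(** * Cardinal arithmetic of infinite types *)

Lemma card_le_setTP (T U : Type) :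
  [set: T] #<= [set: U] <-> exists f : T -> U, injective f.
Proof.
split=> [/card_leP[f]|[f f_inj]].
  exists (fun x => val (f (to_setT x))) => x y /val_inj.
  by move=> /(@inj _ _ _ f) -/(_ (in_setT _) (in_setT _)) [].
have [|g] := (injfunPex (A := [set: T]) (B := [set: U])).2.
  by exists f => // x y _ _ /f_inj.
exact: inj_card_le.
Qed.

(* A maximal family S of injective sequences with disjoint ranges covers T up to
   a finite set, so that T is roughly S * nat. *)
Lemma card_le_setXnat (T : Type) :
  infinite_set [set: T] -> [set: T * nat] #<= [set: T].
Proof.
move=> T_inf.
pose P : set (set (nat -> T)) := [set S |
  forall s t m n, S s -> S t -> s m = t n -> s = t /\ m = n].
have [S [PS Smax]] : exists S, P S /\ forall S', S `<` S' -> ~ P S'.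
  apply: Zorn_bigcup => G GP Gtot s t m n [X GX Xs] [Y GY Yt].
  have [XY|YX] := Gtot _ _ GX GY.
    by apply: (GP _ GY) => //; exact: XY.
  by apply: (GP _ GX) => //; exact: YX.
pose D := [set x | exists s n, S s /\ s n = x].
(* An infinite complement of [D] would contain an injective sequence [h], and adding [h] to [S]
   would contradict maximality. *)
have finD : finite_set (~` D).
  apply: contrapT => /infiniteP.
  rewrite -(card_le_eqr (card_setT _)) => /card_le_setTP[g g_inj].
  pose h n := val (g n).
  have hD n : ~ D (h n) by have /set_mem := valP (g n).
  have Sh : ~ S h by move=> Sh; apply: (hD 0); exists h, 0.
  apply: (Smax (S `|` [set h])).
    by split=> [s Ss|/(_ h (or_intror erefl))//]; left.
  move=> s t m n [Ss|->] [St|->]; first exact: PS.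
  - by move=> smh; case: (hD n); exists s, m.
  - by move=> htn; case: (hD m); exists t, n; split.
  - by move=> /val_inj/g_inj.
have [s0 Ss0] : exists s0, S s0.
  apply: contrapT => S0; apply: T_inf; apply: sub_finite_set finD.
  by move=> x _ [s [n [Ss _]]]; apply: S0; exists s.
have /countable_injP[c c_inj] := finite_set_countable finD.
have code x : exists p : option (nat -> T) * nat,
    if p.1 is Some s then S s /\ s p.2 = x else ~ D x /\ c x = p.2.
  have [[s [n [Ss <-]]]|nDx] := pselect (D x); first by exists (Some s, n).
  by exists (None, c x).
have [e eP] := choice code.
have e_inj : injective e.
  move=> x y exy; move: (eP x) (eP y); rewrite exy.
  case: (e y) => [[s|] n] /= [Hx xn] [Hy yn]; first by rewrite -xn.
  by apply: c_inj; rewrite ?inE// xn.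
apply/card_le_setTP.
(* Points lying on [s] go to odd positions of [s], the finitely many others to even positions of
   [s0]; parity separates the two kinds when [s] is [s0]. *)
pose pr (m k : nat) := choice.pickle (m, k).
exists (fun q => let: (o, m) := e q.1 in
  if o is Some s then s (pr m q.2).*2.+1 else s0 (pr m q.2).*2).
move=> [x k] [y l] /=; move: (eP x) (eP y) (e_inj x y).
have pr_inj m n : pr m k = pr n l -> m = n /\ k = l.
  by move=> /(pcan_inj choice.pickleK)[].
have parity m n : m.*2.+1 <> n.*2.
  by move=> /(congr1 odd); rewrite /= !odd_double.
case: (e x) (e y) => [[s|] m] [[t|] n] /= [Hx _] [Hy _] H.
- move=> /(PS _ _ _ _ Hx Hy)[st [/double_inj/pr_inj[mn ->]]].
  by rewrite H// st mn.
- by move=> /(PS _ _ _ _ Hx Ss0)[_ /parity].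
- by move=> /(PS _ _ _ _ Ss0 Hy)[_ /esym/parity].
- move=> /(PS _ _ _ _ Ss0 Ss0)[_ /double_inj/pr_inj[mn ->]].
  by rewrite H// mn.
Qed.

Lemma card_le_setXr (T K L : Type) (F : set T) : F #<= [set: K] ->
  F `*` [set: L] #<= [set: K * L].
Proof.
rewrite -(card_le_eql (card_setT F)) => /card_le_setTP[f f_inj].
rewrite -(card_le_eql (card_setT _)); apply/card_le_setTP.
pose fst_in (p : F `*` [set: L]) : F :=
  exist _ (val p).1 (mem_set (set_mem (valP p)).1).
exists (fun p => (f (fst_in p), (val p).2)) => p q [/f_inj/(congr1 val) p1 p2].
apply: val_inj; move: p1 p2 => /=.
by case: (val p) (val q) => [a b] [c d] /= -> ->.
Qed.

Lemma card_le_sum (T K L : Type) : infinite_set [set: T] ->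
  [set: K] #<= [set: T] -> [set: L] #<= [set: T] ->
  [set: K + L] #<= [set: T].
Proof.
move=> T_inf /card_le_setTP[f f_inj] /card_le_setTP[g g_inj].
apply: (card_le_trans _ (card_le_setXnat T_inf)); apply/card_le_setTP.
exists (fun z => match z with inl x => (f x, 0) | inr y => (g y, 1) end).
by move=> [x|x] [y|y] // []; [move=> /f_inj->|move=> /g_inj->].
Qed.

Lemma card_le_suml (K L : Type) : [set: K] #<= [set: K + L].
Proof. by apply/card_le_setTP; exists inl => x y []. Qed.

Lemma card_le_sumr (K L : Type) : [set: L] #<= [set: K + L].
Proof. by apply/card_le_setTP; exists inr => x y []. Qed.

Lemma infinite_nat_sum (K : Type) : infinite_set [set: nat + K].
Proof. by apply/infiniteP; exact: card_le_suml. Qed.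

Lemma card_le_nat_sum (K L : Type) : [set: K] #<= [set: L] ->
  [set: nat + K] #<= [set: nat + L].
Proof.
move=> KL; apply: card_le_sum; first exact: infinite_nat_sum.
  exact: card_le_suml.
exact: card_le_trans KL (card_le_sumr _ _).
Qed.

Lemma card_le_setU (T : Type) (A B : set T) : infinite_set B -> A #<= B ->
  A `|` B #<= B.
Proof.
move=> B_inf AB.
rewrite -(card_le_eqr (card_setT B)).
have T_inf : infinite_set [set: B].
  by move=> fB; apply: B_inf; rewrite -(eq_finite_set (card_setT B)).
have : [set: A + B] #<= [set: B].
  apply: card_le_sum => //.
  by rewrite (card_le_eql (card_setT A)) (card_le_eqr (card_setT B)).
apply: card_le_trans.
rewrite -(card_le_eql (card_setT _)); apply/card_le_setTP.
have dec (x : A `|` B) : exists z : A + B,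
    val x = match z with inl a => val a | inr b => val b end.
  have [Ax|Bx] := set_mem (valP x).
    by exists (inl (exist _ (val x) (mem_set Ax))).
  by exists (inr (exist _ (val x) (mem_set Bx))).
have [f fP] := choice dec; exists f => x y fxy.
by apply: val_inj; rewrite fP fxy -fP.
Qed.

Lemma aleph1_infinite : infinite_set [set: aleph1].
Proof.
have [|unc _] := @least_cardP (fun K => ~ countable [set: K]).
  (* Cantor's diagonal argument shows that an uncountable type exists, so [aleph1] is a true
     minimum. *)
  exists (set nat); move=> /card_le_setTP[f f_inj].
  pose D := [set n | exists2 A, f A = n & ~ A n].
  have nD : ~ D (f D) by move=> DfD; have [A /f_inj->] := DfD; exact.
  by apply: (nD); exists D.
by move=> /finite_set_countable.
Qed.

Lemma infinite_card_ge (T U : Type) (A : set T) (B : set U) :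
  infinite_set A -> A #<= B -> infinite_set B.
Proof. by move=> A_inf AB /(card_le_finite AB). Qed.

(** * Sets of cardinality below [kappa] *)

Section small_sets.
Variables (X kappa : Type).
Hypothesis kappa_inf : infinite_set [set: kappa].

Lemma small_sets_le (A B : set X) :
  A #<= B -> small_sets kappa B -> small_sets kappa A.
Proof.
move=> AB [Bk nBk]; split; first exact: card_le_trans Bk.
apply: contra nBk => /card_eqPle[_ kA].
by apply/card_eqPle; split=> //; exact: card_le_trans kA AB.
Qed.

Lemma small_sets_finite (A : set X) : finite_set A -> small_sets kappa A.
Proof.
move=> Afin; split.
  apply: card_le_trans (finite_set_countable Afin) _.
  exact/infiniteP.
by apply/negP => Ak; apply: kappa_inf; rewrite -(eq_finite_set Ak).
Qed.

(** If the larger set is infinite it absorbs the other one; if it is finite, so is the union. *)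
Lemma small_setsU (A B : set X) :
  small_sets kappa A -> small_sets kappa B -> small_sets kappa (A `|` B).
Proof.
wlog AB : A B / A #<= B => [th sA sB|sA sB].
  have := card_le_total A B.
  rewrite (card_le_eql (card_setT A)) (card_le_eql (card_setT B)).
  rewrite (card_le_eqr (card_setT A)) (card_le_eqr (card_setT B)).
  by move=> [AB|BA]; [exact: th|rewrite setUC; exact: th].
have [Bfin|Binf] := pselect (finite_set B).
  apply: small_sets_finite; rewrite finite_setU; split=> //.
  exact: card_le_finite AB Bfin.
by apply: small_sets_le sB; exact: card_le_setU.
Qed.

End small_sets.

(** * Sup-balls and the topology they generate *)

Section sup_ball_topology.
Variables (R : realType) (X : topologicalType) (kappa : Type).
Local Open Scope ring_scope.
Implicit Types (f g h : Ckappa R X kappa) (A B : set X) (e : R).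

Let ev f (x : X) : R := (f : continuousType X R) x.

Lemma sup_ballP f A e g : 0 < e ->
  sup_ball f A e g <->
  exists2 d, d < e & forall x, A x -> `|ev f x - ev g x| <= d.
Proof.
move=> e0; rewrite /sup_ball/=; split.
  set s := ereal_sup _ => se.
  have sub x : A x -> (`|ev f x - ev g x|%:E <= s)%E.
    by move=> Ax; apply: ereal_sup_ubound; exists x.
  move: s se sub => [r| |] //=.
    by rewrite lte_fin => re sub; exists r.
  (* Here the supremum is [-oo], so [A] is empty and [0] is a vacuous bound. *)
  by move=> _ sub; exists 0 => // x /sub.
move=> [d de dP]; apply: (@le_lt_trans _ _ d%:E); last by rewrite lte_fin.
by apply: ge_ereal_sup => _ [x Ax <-]; rewrite lee_fin; exact: dP.
Qed.

Lemma sup_ball_center f A e : 0 < e -> sup_ball f A e f.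
Proof.
by move=> e0; apply/sup_ballP => //; exists 0 => // x _; rewrite subrr normr0.
Qed.

Lemma sup_ball_sym f A e g : 0 < e -> sup_ball f A e g -> sup_ball g A e f.
Proof.
move=> e0 /(sup_ballP _ _ _ e0)[d de dP]; apply/sup_ballP => //.
by exists d => // x Ax; rewrite distrC; exact: dP.
Qed.

Lemma sup_ball_triangle f g h A e1 e2 : 0 < e1 -> 0 < e2 ->
  sup_ball f A e1 g -> sup_ball g A e2 h -> sup_ball f A (e1 + e2) h.
Proof.
move=> e10 e20 /(sup_ballP _ _ _ e10)[d1 de1 P1].
move=> /(sup_ballP _ _ _ e20)[d2 de2 P2].
apply/sup_ballP; first exact: addr_gt0.
exists (d1 + d2) => [|x Ax]; first exact: ltrD.
by rewrite (le_trans (ler_distD (ev g x) _ _))// lerD// ?P1 ?P2.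
Qed.

(** By continuity the points where [|f - g| <= d] form a closed set, so a bound on [B] extends to
    its closure. *)
Lemma sup_ball_closure f A B e e' : A `<=` closure B -> 0 < e -> e <= e' ->
  sup_ball f B e `<=` sup_ball f A e'.
Proof.
move=> AB e0 ee' g /(sup_ballP _ _ _ e0)[d de dP].
apply/sup_ballP; first exact: lt_le_trans ee'.
exists d => [|x /AB clBx]; first exact: lt_le_trans ee'.
have cD : closed [set y | `|ev f y - ev g y| <= d].
  apply: (@closed_comp _ _ (fun y => `|ev f y - ev g y|) [set r | r <= d]).
    move=> y _; apply: (@cvg_norm _ _ _ (nbhs y)).
    by apply: cvgB; exact: cts_fun.
  exact: closed_le.
by rewrite closureE in clBx; exact: clBx (conj cD dP).
Qed.

Lemma sup_ball_sub f A B e e' : A `<=` B -> 0 < e -> e <= e' ->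
  sup_ball f B e `<=` sup_ball f A e'.
Proof.
by move=> AB; apply: sup_ball_closure => x /AB; exact: subset_closure.
Qed.

Lemma open_sup_ball f A e :
  small_sets kappa A -> 0 < e -> open (sup_ball f A e).
Proof.
move=> sA e0; exists [set sup_ball f A e]; last by rewrite bigcup_set1.
move=> _ ->; apply: (@finI_from1 _ _ _ id); by exists f, A, e.
Qed.

Hypothesis kappa_inf : infinite_set [set: kappa].

(** [C] and [c] are chosen before [f], so that one pair serves both neighbourhoods of a point and
    entourages. *)
Lemma sup_ball_setU A B d e :
  small_sets kappa A -> small_sets kappa B -> 0 < d -> 0 < e ->
  exists C c, [/\ small_sets kappa C, 0 < c &
    forall f, sup_ball f C c `<=` sup_ball f A d `&` sup_ball f B e].
Proof.
move=> sA sB d0 e0; exists (A `|` B), (Order.min d e).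
have m0 : 0 < Order.min d e by rewrite lt_min d0 e0.
split=> // [|f g gAB]; first exact: small_setsU.
split; apply: sup_ball_sub gAB => //.
- by rewrite ge_min lexx.
- by rewrite ge_min lexx orbT.
Qed.

(** Lets [open_sup_ball_sub] treat finite intersections of subbasic sets one set at a time. *)
Lemma sup_ball_filter f : Filter [set V : set (Ckappa R X kappa) |
  exists A e, [/\ small_sets kappa A, 0 < e & sup_ball f A e `<=` V]].
Proof.
split.
- by exists set0, 1; split=> //; exact: small_sets_finite.
- move=> V W [A [d [sA d0 AV]]] [B [e [sB e0 BW]]].
  have [C [c [sC c0 CAB]]] := sup_ball_setU sA sB d0 e0.
  by exists C, c; split=> // g /CAB[/AV Vg /BW].
- move=> V W VW [A [e [sA e0 AV]]]; exists A, e; split=> //.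
  exact: subset_trans VW.
Qed.

Lemma open_sup_ball_sub f (U : set (Ckappa R X kappa)) : open U -> U f ->
  exists A e, [/\ small_sets kappa A, 0 < e & sup_ball f A e `<=` U].
Proof.
move=> [D' D'sub <-] [V V' Vf].
apply: (@filterS _ _ (sup_ball_filter f) V).
  by move=> g Vg; exists V.
have [E Esub EV] := D'sub _ V'.
move: Vf; rewrite -EV => Vf.
apply: (@filter_bigI _ _ _ _ _ (sup_ball_filter f)) => W EW.
have /set_mem[g [A [e [sA e0 Wg]]]] := Esub _ EW.
have := Vf _ EW; rewrite /= Wg => /(sup_ballP _ _ _ e0)[d de dP].
(* [d < e] bounds [|g - f|] on [A], so the ball of radius [e - d] about [f] lies in the ball of
   radius [e] about [g]. *)
exists A, (e - d); split=> //; first by rewrite subr_gt0.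
have ed0 : 0 < e - d by rewrite subr_gt0.
move=> h /(sup_ballP _ _ _ ed0)[c ced cP].
apply/sup_ballP => //; exists (d + c).
  by rewrite addrC -ltrBrDr.
by move=> x Ax; rewrite (le_trans (ler_distD (ev f x) _ _))// lerD// ?dP ?cP.
Qed.

(** * The uniformity of uniform convergence on small sets *)

Definition sup_entourage : set_system (Ckappa R X kappa * Ckappa R X kappa) :=
  [set V | exists A e, [/\ small_sets kappa A, 0 < e &
    forall f g, sup_ball f A e g -> V (f, g)]].

Lemma compatible_sup_entourage : compatible_uniformity sup_entourage.
Proof.
split.
- split.
  + by exists set0, 1; split=> //; exact: small_sets_finite.
  + move=> V W [A [d [sA d0 AV]]] [B [e [sB e0 BW]]].
    have [C [c [sC c0 CAB]]] := sup_ball_setU sA sB d0 e0.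
    by exists C, c; split=> // f g /CAB[/AV Vfg /BW].
  + move=> V W VW [A [e [sA e0 AV]]]; exists A, e; split=> // f g fg.
    by apply: VW; exact: AV.
- move=> V [A [e [sA e0 AV]]] [f g] /= fg.
  have {fg}<- : f = g := fg; apply: AV; exact: sup_ball_center.
- move=> V [A [e [sA e0 AV]]]; exists A, e; split=> // f g fg.
  by apply: AV; exact: sup_ball_sym.
- move=> V [A [e [sA e0 AV]]].
  have e20 : 0 < e / 2 by rewrite divr_gt0.
  exists [set p | sup_ball p.1 A (e / 2) p.2]; first by exists A, (e / 2).
  move=> [f h] [g /= fg gh]; apply: AV; rewrite [e]splitr.
  exact: sup_ball_triangle fg gh.
- apply/funext => f; apply/seteqP; split=> U.
  + rewrite nbhsE => -[V [oV Vf] VU].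
    have [A [e [sA e0 AV]]] := open_sup_ball_sub oV Vf.
    exists [set p | sup_ball p.1 A e p.2]; first by exists A, e.
    by move=> g /xsectionP/AV/VU.
  + move=> [V [A [e [sA e0 AV]]] VU]; rewrite nbhsE.
    exists (sup_ball f A e).
      by split; [exact: open_sup_ball|exact: sup_ball_center].
    by move=> g fg; apply: VU; apply/xsectionP; exact: AV.
Qed.

Lemma closed_family_sup_base (F : set (set X)) : closed_family kappa F ->
  uniformity_base sup_entourage
    [set [set p | sup_ball p.1 A n.+1%:R^-1 p.2] | A in F & n in [set: nat]].
Proof.
move=> [Fsmall Fcl]; split.
  move=> _ [A FA [n _ <-]]; exists A, n.+1%:R^-1; split=> //; exact: Fsmall.
move=> V [A [e [sA e0 AV]]]; have [B FB AB] := Fcl _ sA.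
have [n ne] : exists n, n.+1%:R^-1 < e.
  have /= [n _ /(_ n (leqnn n)) ne] := near_infty_natSinv_lt (PosNum e0).
  by exists n.
exists [set p | sup_ball p.1 B n.+1%:R^-1 p.2].
  by exists B => //; exists n.
move=> [f g] /= fg; apply: AV; apply: sup_ball_closure fg => //; exact: ltW.
Qed.

(** * Closed families from local pi-bases *)

Lemma local_pi_base_closed_family (f : Ckappa R X kappa) V :
  completely_regular_space X -> local_pi_base f V ->
  exists2 F : set (set X), closed_family kappa F & F #<= V.
Proof.
move=> crX [Vopen Vbase].
(* Stated for all [W] so that [choice] applies; outside [V] the empty set is a default. *)
have inner (W : set (Ckappa R X kappa)) : exists A, V W ->
    small_sets kappa A /\ exists g e, 0 < e /\ sup_ball g A e `<=` W.
  have [VW|nVW] := pselect (V W); last by exists set0.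
  have [oW [g Wg]] := Vopen _ VW.
  have [A [e [sA e0 AW]]] := open_sup_ball_sub oW Wg.
  by exists A => _; split=> //; exists g, e.
have [a aP] := choice inner.
exists (a @` V); last exact: card_image_le.
split=> [_ [W VW <-]|A sA]; first by have [] := aP _ VW.
have [|W VW WU] := Vbase (sup_ball f A 1).
  by split; [exact: open_sup_ball|exact: sup_ball_center].
exists (a W); first by exists W.
have [_ [g [e [e0 gW]]]] := aP _ VW.
apply: contrapT => /existsNP[x /not_implyP[Ax nclx]].
(* [u] is 0 at [x] and 1 on the closure of [a W], so [g + 2 * (1 - u)] agrees with [g] on [a W] and
   exceeds it by 2 at [x]. *)
have /(@uniform_separatorP _ R)[u [uc _ ux u0]] :=
  crX x _ (@closed_closure _ (a W)) nclx.
have kc : continuous (fun y => ev g y + 2 * (1 - u y)).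
  move=> y; apply: cvgD; first exact: cts_fun.
  apply: cvgM; first exact: cvg_cst.
  by apply: cvgB; [exact: cvg_cst|exact: uc].
pose k : Ckappa R X kappa := mkcts kc.
have kW : W k.
  apply: gW; apply/sup_ballP => //; exists 0 => // y ay.
  have -> : ev k y = ev g y + 2 * (1 - u y) by [].
  have -> : u y = 1 by apply: u0; exists y => //; exact: subset_closure.
  by rewrite subrr mulr0 addr0 subrr normr0.
(* Both [k] and [g] lie in [W], hence at distance less than 1 from [f] at [x], although they differ
   by 2 there. *)
have /(sup_ballP _ _ _ ltr01)[d d1 /(_ _ Ax)] := WU _ kW.
have Wg : W g by apply: gW; exact: sup_ball_center.
have /(sup_ballP _ _ _ ltr01)[d' d'1 /(_ _ Ax)] := WU _ Wg.
have -> : ev k x = ev g x + 2.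
  have -> : ev k x = ev g x + 2 * (1 - u x) by [].
  have -> : u x = 0 by apply: ux; exists x.
  by rewrite subr0 mulr1.
rewrite !ler_norml => /andP[_ fg] /andP[fk _].
by lra.
Qed.

End sup_ball_topology.

(** * Attained minima and suprema of cardinals *)

Lemma card_le_least_card (P : Type -> Prop) (K : Type) :
  P K -> [set: least_card P] #<= [set: K].
Proof. by move=> PK; have [|_ +] := @least_cardP P; [exists K|exact]. Qed.

(** Up to the summand [nat], this is the shape of [cc], [character_at] and [pi_character_at]; it
    lets a family of least size be fixed. *)
Lemma least_card_set (T : Type) (Q : set (set T)) :
  Q !=set0 ->
  exists2 F, Q F &
    [set: least_card (fun K => exists2 F, Q F & [set: K] #= F)] #= F.
Proof.
move=> [F QF]; have [|+ _] :=
    @least_cardP (fun K => exists2 F, Q F & [set: K] #= F).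
  by exists F, F.
by move=> [G QG KG]; exists G.
Qed.

Lemma least_card_set_le (T : Type) (Q : set (set T)) (F : set T) : Q F ->
  [set: least_card (fun K => exists2 F, Q F & [set: K] #= F)] #<= F.
Proof.
move=> QF; rewrite -(card_le_eqr (card_setT F)).
by apply: card_le_least_card; exists F.
Qed.

Lemma card_sup_ge (I : Type) (k : I -> Type) (i : I) :
  [set: k i] #<= [set: card_sup k].
Proof.
have [|+ _] := @least_cardP (fun K => forall i, [set: k i] #<= [set: K]).
  (* The disjoint union is an upper bound, so [card_sup] is not the default value. *)
  exists {i : I & k i} => j; apply/card_le_setTP; exists (existT k j).
  move=> x y xy; have := projT2_eq xy.
  (* Both indices are [j], so proof irrelevance removes the transport. *)
  by rewrite (Prop_irrelevance (projT1_eq xy) erefl).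
exact.
Qed.

Lemma card_sup_le (I : Type) (k : I -> Type) (K : Type) :
  (forall i, [set: k i] #<= [set: K]) -> [set: card_sup k] #<= [set: K].
Proof. exact: card_le_least_card. Qed.

(** One compatible uniformity with a base of size at most [K] ensures that the minimum defining
    [uniform_weight] is attained. *)
Lemma uniform_weightP (Y : topologicalType) (K : Type)
    (E F : set_system (Y * Y)) :
  infinite_set [set: K] -> compatible_uniformity E -> uniformity_base E F ->
  F #<= [set: K] ->
  [/\ infinite_set [set: uniform_weight Y],
      [set: uniform_weight Y] #<= [set: K] &
      exists E' F' : set_system (Y * Y), [/\ compatible_uniformity E',
        uniformity_base E' F' & F' #<= [set: uniform_weight Y]]].
Proof.
move=> Kinf cE bF FK.
pose P := fun K : Type => infinite_set [set: K] /\
    exists E F : set_system (Y * Y),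
      [/\ compatible_uniformity E, uniformity_base E F & F #<= [set: K]].
have PK : P K by split=> //; exists E, F.
have [|[uinf uEF] umin] := @least_cardP P; first by exists K.
by split=> //; exact: umin.
Qed.

(** * Pi-character, character and bases of uniformities *)

Lemma local_base_open_nbhs (Y : topologicalType) (y : Y) :
  local_base y (open_nbhs y).
Proof. by split=> // U yU; exists U. Qed.

Lemma local_pi_base_local_base (Y : topologicalType) (y : Y)
  (F : set (set Y)) : local_base y F -> local_pi_base y F.
Proof. by move=> [Fy Fb]; split=> // V /Fy[oV Vy]; split=> //; exists y. Qed.

Lemma pi_character_le (Y : topologicalType) :
  [set: pi_character Y] #<= [set: character Y].
Proof.
apply: card_sup_le => y; apply: card_le_trans (card_sup_ge _ y).
apply: card_le_nat_sum.
have [|F Fy KF] := @least_card_set _ [set F | local_base y F].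
  by exists (open_nbhs y); exact: local_base_open_nbhs.
rewrite (card_le_eqr KF); apply: least_card_set_le.
exact: local_pi_base_local_base.
Qed.

Lemma character_le (Y : topologicalType) (K : Type)
    (E F : set_system (Y * Y)) :
  infinite_set [set: K] -> compatible_uniformity E -> uniformity_base E F ->
  F #<= [set: K] -> [set: character Y] #<= [set: K].
Proof.
move=> Kinf [_ _ _ _ nbhsE'] [FE Fb] FK.
apply: card_sup_le => y; apply: card_le_sum => //; first exact/infiniteP.
apply: (card_le_trans _ FK).
(* A section of an entourage is a neighbourhood of [y] but need not be open; hence the interiors. *)
apply: card_le_trans (card_image_le (fun V => (xsection V y)^°) F).
apply: least_card_set_le; split=> [_ [V /FE EV <-]|U [oU Uy]].
  by split; [exact: open_interior|rewrite /interior/= nbhsE'; exists V].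
have : nbhs y U by exact: open_nbhs_nbhs.
rewrite nbhsE' => -[V /Fb[W FW WV] VU].
exists (xsection W y)^°; first by exists W.
by move=> x /interior_subset/xsectionP/WV Vx; apply: VU; exact/xsectionP.
Qed.

Theorem theorem5p19 (R : realType) (X : topologicalType) (kappa : Type)
    (tychX : tychonoff_space X) (kappa_ge : [set: aleph1] #<= [set: kappa]) :
  let C := Ckappa R X kappa in
  [/\ [set: pi_character C] #= [set: character C],
      [set: character C] #= [set: uniform_weight C] &
      [set: uniform_weight C] #= [set: cc X kappa]].
Proof.
move=> C.
have kappa_inf := infinite_card_ge aleph1_infinite kappa_ge.
have [|F Fcl KF] := @least_card_set _ [set F | closed_family (X := X) kappa F].
  (* The family of all small sets is closed, so the minimum in [cc] exists. *)
  exists (small_sets kappa); split=> // A sA; exists A => //.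
  exact: subset_closure.
have base := closed_family_sup_base R Fcl.
have cS := compatible_sup_entourage R X kappa_inf.
have [|uinf uw_le_cc [E [G [cE bG Gu]]]] :=
    uniform_weightP (@infinite_nat_sum _) cS base (K := cc X kappa).
  (* The base is indexed by [F] times [nat], and the infinite cardinal [cc] absorbs the factor
     [nat]. *)
  rewrite image2E; apply: card_le_trans (card_image_le _ _) _.
  apply: (card_le_trans _ (card_le_setXnat (@infinite_nat_sum _))).
  apply: card_le_setXr.
  by rewrite -(card_le_eql KF); exact: card_le_sumr.
have ch_le_uw := character_le uinf cE bG Gu.
have pich_le_ch := pi_character_le C.
have cc_le_pich : [set: cc X kappa] #<= [set: pi_character C].
  (* A supremum dominates its value at any one point, so a single function suffices. *)
  have zero : C := cst 0%R : continuousType X R.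
  apply: card_le_trans (card_sup_ge _ zero).
  apply: card_le_nat_sum.
  have [|V Vb KV] := @least_card_set _ [set V | local_pi_base zero V].
    exists (open_nbhs zero); apply: local_pi_base_local_base.
    exact: local_base_open_nbhs.
  have [G' clG' G'V] := local_pi_base_closed_family kappa_inf tychX.1 Vb.
  rewrite (card_le_eqr KV); apply: (card_le_trans _ G'V).
  exact: least_card_set_le.
(* By Cantor-Bernstein, each equality follows from one inequality and the other three of the
   cycle. *)
split; rewrite card_eq_le.
- by rewrite pich_le_ch (card_le_trans ch_le_uw (card_le_trans uw_le_cc _)).
- by rewrite ch_le_uw (card_le_trans uw_le_cc (card_le_trans cc_le_pich _)).
- by rewrite uw_le_cc (card_le_trans cc_le_pich (card_le_trans pich_le_ch _)).
Qed.
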